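(* Let $\gamma\ge 3$, $\kappa>\gamma$, $m\ge 1$, $M\ge 2$ be integers and let $\mathbf{P}=[p_{i,j}]_{0\le i\le m,\,0\le j\le M-1}$ be a probability-distribution matrix with associated probability-distribution vector $\mathbf{p}^{\mathrm{con}}$ and coupling polynomial $f(X,Y)=\sum_{i=0}^{m}\sum_{j=0}^{M-1}p_{i,j}X^iY^j$. Denote by $P_6(\mathbf{p}^{\mathrm{con}})$ the probability that a given cycle-$6$ candidate in the all-one $\gamma\times\kappa$ base matrix becomes a cycle-$6$ candidate in the MD protograph under random partitioning and relocations with respect to $\mathbf{p}^{\mathrm{con}}$. Then $$P_6(\mathbf{p}^{\mathrm{con}})=\sum_{M\mid b}\left[f^3(X,Y)\,f^3(X^{-1},Y^{-1})\right]_{0,b}.$$ Consequently, the expected number $N_6(\mathbf{p}^{\mathrm{con}})$ of cycle-$6$ candidates in the MD protograph is $$N_6(\mathbf{p}^{\mathrm{con}})=6\binom{\gamma}{3}\binom{\kappa}{3}\sum_{M\mid b}\left[f^3(X,Y)\,f^3(X^{-1},Y^{-1})\right]_{0,b}.$$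
   Context: Probability-distribution matrix: an $(m+1)\times M$ real matrix $\mathbf{P}=[p_{i,j}]$ with all $p_{i,j}\in[0,1]$ and $\sum_{i=0}^m\sum_{j=0}^{M-1}p_{i,j}=1$; $\mathbf{p}^{\mathrm{con}}$ is the vector of length $(m+1)M$ obtained by concatenating its rows from top to bottom. Notation: $[\cdot]_{i,j}$ denotes the coefficient of $X^iY^j$ in a two-variable Laurent polynomial; $\sum_{M\mid b}$ is the sum over all integers $b$ (positive, negative or zero) divisible by $M$; $f^k(X,Y)$ means $(f(X,Y))^k$. Random partitioning and relocations: each position $(i,j)$ of the all-one $\gamma\times\kappa$ base matrix is independently assigned a random pair $(\mathbf{K}(i,j),\mathbf{M}(i,j))\in\{0,\dots,m\}\times\{0,\dots,M-1\}$, equal to $(x,u)$ with probability $p_{x,u}$. Here $\mathbf{K}$ is the partitioning matrix ($\mathbf{K}(i,j)$ is the index of the component matrix receiving the entry) and $\mathbf{M}$ is the relocation matrix ($\mathbf{M}(i,j)$ is the index of the auxiliary matrix receiving the entry, index $0$ meaning no relocation). Cycle-$6$ candidate in the base matrix: a $6$-cycle $(i_1,j_1,i_2,j_2,i_3,j_3)$ with distinct rows $i_1,i_2,i_3\in\{1,\dots,\gamma\}$ and distinct columns $j_1,j_2,j_3\in\{1,\dots,\kappa\}$, having edges (entries) $(i_k,j_k)$ and $(i_k,j_{k+1})$ for $1\le k\le 3$, with $j_4=j_1$. Candidates are counted as cycles, i.e., up to the choice of starting point and direction of traversal. A cycle-$6$ candidate of the base matrix becomes a cycle-$6$ candidate in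 the MD protograph if and only if both $$\sum_{k=1}^{3}[\mathbf{K}(i_k,j_k)-\mathbf{K}(i_k,j_{k+1})]=0\quad\text{and}\quad \sum_{k=1}^{3}[\mathbf{M}(i_k,j_k)-\mathbf{M}(i_k,j_{k+1})]\equiv 0\pmod M.$$ The number of cycle-$6$ candidates in the MD protograph is the number of cycle-$6$ candidates of the base matrix that satisfy these two conditions (copies arising from replicas are not counted separately); $N_6(\mathbf{p}^{\mathrm{con}})$ is its expectation. *)

(* Defs.v *)
From HB Require Import structures.
From mathcomp Require Import all_boot all_order all_algebra finmap.
From mathcomp Require Import all_classical all_reals all_analysis.

Set Implicit Arguments.
Unset Strict Implicit.
Unset Printing Implicit Defensive.

Import Order.TTheory GRing.Theory Num.Theory.

Local Open Scope classical_set_scope.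
Local Open Scope ring_scope.

(* Two-variable Laurent polynomials over R, i.e. R[X, X^-1, Y, Y^-1]: the value
   at (a, b) of the finitely supported function is the coefficient of
   X^a Y^b. *)
Definition laurent (R : comNzRingType) : Type :=
  {fsfun int * int -> R with 0}.

Section LaurentRing.
Variable R : comNzRingType.
Implicit Types (f g h : laurent R) (k u v w : int * int) (c : R).
Local Notation supp f := (finsupp (f : {fsfun int * int -> R with 0})).

HB.instance Definition _ := Choice.on (laurent R).

Definition lcoef f (a b : int) : R := (f : {fsfun _ -> R with 0}) (a, b).

Local Notation "f .` k" := (lcoef f k.1 k.2) (at level 2).

Definition lmonom c (a b : int) : laurent R :=
  [fsfun k in [fset (a, b)]%fset => c].

Definition ladd f g : laurent R :=
  [fsfun k in (supp f `|` supp g)%fset => f.`k + g.`k].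
Definition lopp f : laurent R := [fsfun k in supp f => - f.`k].
Definition lmul f g : laurent R :=
  [fsfun k in [fset (u + v)%R | u in supp f, v in supp g]%fset =>
     \sum_(u <- supp f) \sum_(v <- supp g | u + v == k) f.`u * g.`v].

Lemma laurentP f g : (forall k, f.`k = g.`k) -> f = g.
Proof. by move=> e; apply/fsfunP => -[a b]; exact: (e (a, b)). Qed.

Lemma lcoef_supp f k : k \notin supp f -> f.`k = 0.
Proof. by case: k => a b; exact: fsfun_dflt. Qed.

Lemma lmonomE c a b k : (lmonom c a b).`k = if k == (a, b) then c else 0.
Proof. by case: k => x y; rewrite /lcoef fsfunE inE. Qed.

Lemma supp_lmonom c a b : (supp (lmonom c a b) `<=` [fset (a, b)])%fset.
Proof.
apply/fsubsetP => -[x y]; rewrite mem_finsupp inE.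
have /= := lmonomE c a b (x, y); rewrite /lcoef => ->.
by case: ifP; rewrite ?eqxx.
Qed.

Lemma laddE f g k : (ladd f g).`k = f.`k + g.`k.
Proof.
case: k => a b; rewrite {1}/lcoef fsfunE inE /=.
case: ifPn => //; rewrite negb_or => /andP[hf hg].
by have /= -> := lcoef_supp hf; have /= -> := lcoef_supp hg; rewrite addr0.
Qed.

Lemma loppE f k : (lopp f).`k = - f.`k.
Proof.
case: k => a b; rewrite {1}/lcoef fsfunE /=.
by case: ifPn => // hf; have /= -> := lcoef_supp hf; rewrite oppr0.
Qed.

Lemma big_supp (f : laurent R) (A : {fset int * int}) (F : int * int -> R) :
  (supp f `<=` A)%fset -> (forall u, f.`u = 0 -> F u = 0) ->
  \sum_(u <- supp f) F u = \sum_(u <- A) F u.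
Proof.
move=> sfA F0; apply: big_fset_incl => // u uA uf.
by apply: F0; exact: lcoef_supp.
Qed.

Lemma lmulE f g k (A B : {fset int * int}) :
  (supp f `<=` A)%fset -> (supp g `<=` B)%fset ->
  (lmul f g).`k = \sum_(u <- A) \sum_(v <- B) f.`u * g.`v *+ (u + v == k).
Proof.
move=> fA gB.
transitivity (\sum_(u <- supp f) \sum_(v <- supp g)
  f.`u * g.`v *+ (u + v == k)).
  have split_if : forall u,
      \sum_(v <- supp g | u + v == k) f.`u * g.`v =
      \sum_(v <- supp g) f.`u * g.`v *+ (u + v == k).
    move=> u; rewrite big_mkcond /=; apply: eq_bigr => v _.
    by case: eqP.
  case: k split_if => a b split_if; rewrite {1}/lcoef fsfunE; case: ifPn.
    by move=> _; apply: eq_bigr => u _; rewrite split_if.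
  move=> /negP hk; apply/esym; rewrite big_seq; apply: big1 => u uf.
  rewrite big_seq; apply: big1 => v vg; case: eqP => // e.
  by exfalso; apply: hk; rewrite -e; apply/imfset2P; exists u => //; exists v.
rewrite (big_supp fA) => [|u fu0]; last first.
  by apply: big1 => v _; rewrite fu0 mul0r mul0rn.
apply: eq_bigr => u _; apply: big_supp => // v gv0.
by rewrite gv0 mulr0 mul0rn.
Qed.

Lemma lzeroE k : (lmonom 0 0 0).`k = 0.
Proof. by rewrite lmonomE if_same. Qed.

Fact laddA : associative ladd.
Proof. by move=> f g h; apply: laurentP => k; rewrite !laddE addrA. Qed.
Fact laddC : commutative ladd.
Proof. by move=> f g; apply: laurentP => k; rewrite !laddE addrC. Qed.
Fact ladd0 : left_id (lmonom 0 0 0) ladd.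
Proof. by move=> f; apply: laurentP => k; rewrite laddE lzeroE add0r. Qed.
Fact laddN : left_inverse (lmonom 0 0 0) lopp ladd.
Proof.
by move=> f; apply: laurentP => k; rewrite laddE loppE lzeroE addNr.
Qed.

HB.instance Definition _ :=
  GRing.isZmodule.Build (laurent R) laddA laddC ladd0 laddN.

Fact lmulC : commutative lmul.
Proof.
move=> f g; apply: laurentP => k.
rewrite (lmulE k (fsubset_refl _) (fsubset_refl _)).
rewrite (lmulE k (fsubset_refl _) (fsubset_refl _)) exchange_big /=.
apply: eq_bigr => u _; apply: eq_bigr => v _.
by rewrite mulrC addrC.
Qed.

Fact lmul1 : left_id (lmonom 1 0 0) lmul.
Proof.
move=> f; apply: laurentP => k.
rewrite (lmulE k (supp_lmonom _ _ _) (fsubset_refl _)) big_seq_fset1 lmonomE eqxx.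
under eq_bigr do rewrite mul1r add0r.
have [kf|kf] := boolP (k \in supp f).
  rewrite (big_fsetD1 k) //= eqxx mulr1n big_seq big1 ?addr0 // => v.
  by rewrite !inE => /andP[/negPf-> _].
rewrite lcoef_supp // big_seq big1 // => v vf.
by case: eqP => // e; rewrite -e vf in kf.
Qed.

Fact lmulDl : left_distributive lmul ladd.
Proof.
move=> f g h; apply: laurentP => k.
pose A := (supp f `|` supp g `|` supp (ladd f g))%fset.
have sf : (supp f `<=` A)%fset by rewrite /A -fsetUA fsubsetUl.
have sg : (supp g `<=` A)%fset by rewrite /A (fsetUC (supp f)) -fsetUA fsubsetUl.
have sfg : (supp (ladd f g) `<=` A)%fset by rewrite /A fsubsetUr.
rewrite laddE (lmulE k sf (fsubset_refl _)) (lmulE k sg (fsubset_refl _)).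
rewrite (lmulE k sfg (fsubset_refl _)) -big_split; apply: eq_bigr => u _ /=.
rewrite -big_split; apply: eq_bigr => v _ /=.
by rewrite laddE mulrDl mulrnDl.
Qed.

Lemma lmul3E f g h k :
  (lmul (lmul f g) h).`k =
  \sum_(u <- supp f) \sum_(v <- supp g) \sum_(w <- supp h)
    f.`u * g.`v * h.`w *+ (u + v + w == k).
Proof.
pose A := (supp (lmul f g) `|`
  [fset (u + v)%R | u in supp f, v in supp g])%fset.
have sA : (supp (lmul f g) `<=` A)%fset by rewrite /A fsubsetUl.
rewrite (lmulE k sA (fsubset_refl _)).
transitivity (\sum_(x <- A) \sum_(w <- supp h) \sum_(u <- supp f)
  \sum_(v <- supp g)
    f.`u * g.`v * h.`w *+ (u + v + w == k) *+ (u + v == x)).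
  apply: eq_bigr => x _; apply: eq_bigr => w _.
  rewrite (lmulE x (fsubset_refl _) (fsubset_refl _)) mulr_suml -sumrMnl.
  apply: eq_bigr => u _; rewrite mulr_suml -sumrMnl.
  apply: eq_bigr => v _.
  by case: (u + v =P x) => [->|_]; rewrite ?mulr1n ?mulr0n ?mul0r ?mul0rn.
under eq_bigr do rewrite exchange_big /=.
rewrite exchange_big /= big_seq [RHS]big_seq; apply: eq_bigr => u uf.
under eq_bigr do rewrite exchange_big /=.
rewrite exchange_big /= big_seq [RHS]big_seq; apply: eq_bigr => v vg.
rewrite exchange_big /=; apply: eq_bigr => w _.
have uvA : u + v \in A.
  by rewrite inE; apply/orP; right; apply/imfset2P; exists u => //; exists v.
rewrite (big_fsetD1 (u + v)) //= eqxx mulr1n big_seq big1 ?addr0 // => x.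
by rewrite !inE eq_sym => /andP[/negPf-> _].
Qed.

Fact lmulA : associative lmul.
Proof.
move=> f g h; apply: laurentP => k.
rewrite [lmul f _]lmulC !lmul3E.
under eq_bigr do rewrite exchange_big /=.
rewrite exchange_big /=; apply: eq_bigr => u _.
apply: eq_bigr => v _; apply: eq_bigr => w _.
by rewrite addrC addrA mulrC mulrA.
Qed.

Fact lone_neq0 : lmonom 1 0 0 != lmonom 0 0 0.
Proof.
apply/eqP => e; have := lzeroE (0, 0); rewrite -e lmonomE eqxx.
by move/eqP; rewrite oner_eq0.
Qed.

HB.instance Definition _ := GRing.Zmodule_isComNzRing.Build (laurent R)
  lmulA lmulC lmul1 lmulDl lone_neq0.

Definition lunit : pred (laurent R) :=
  fun f => `[< exists g : laurent R, g * f = 1 >].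
Definition linv f : laurent R :=
  if pselect (exists g : laurent R, g * f = 1) is left ex
  then projT1 (cid ex) else f.

Fact lmulVf : {in lunit, left_inverse 1 linv *%R}.
Proof.
move=> f /asboolP ex; rewrite /linv; case: pselect => // ex'.
exact: (projT2 (cid ex')).
Qed.
Fact lunitP f g : g * f = 1 -> lunit f.
Proof. by move=> e; apply/asboolP; exists g. Qed.
Fact linv_out : {in [predC lunit], linv =1 id}.
Proof.
by move=> f /asboolP nex; rewrite /linv; case: pselect.
Qed.

HB.instance Definition _ := GRing.ComNzRing_hasMulInverse.Build (laurent R)
  lmulVf lunitP linv_out.

Definition lX : laurent R := lmonom 1 1 0.
Definition lY : laurent R := lmonom 1 0 1.

End LaurentRing.

Arguments lX {R}.
Arguments lY {R}.

(* In a comUnitRingType, t^-1 is the inverse only when t is a unit, so that the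
   following lemmas are needed for lX^-1 and lY^-1 to mean X^-1 and Y^-1. *)
Lemma lmonomM (R : comNzRingType) (c d : R) (a b a' b' : int) :
  lmonom c a b * lmonom d a' b' = lmonom (c * d) (a + a') (b + b').
Proof.
apply: laurentP => k.
rewrite (lmulE k (supp_lmonom _ _ _) (supp_lmonom _ _ _)) !big_seq_fset1 !lmonomE !eqxx.
by rewrite eq_sym; case: eqP.
Qed.

Lemma lX_inv (R : comNzRingType) : lX^-1 = lmonom 1 (-1) 0 :> laurent R.
Proof.
have e : lmonom 1 (-1) 0 * lX = 1 :> laurent R.
  by rewrite lmonomM mulr1 addNr addr0.
have u : (lX : laurent R) \is a GRing.unit by apply: (lunitP e).
by rewrite -[RHS]mulr1 -(mulrV u) mulrA e mul1r.
Qed.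

Lemma lY_inv (R : comNzRingType) : lY^-1 = lmonom 1 0 (-1) :> laurent R.
Proof.
have e : lmonom 1 0 (-1) * lY = 1 :> laurent R.
  by rewrite lmonomM mulr1 addNr addr0.
have u : (lY : laurent R) \is a GRing.unit by apply: (lunitP e).
by rewrite -[RHS]mulr1 -(mulrV u) mulrA e mul1r.
Qed.

Section Distribution.
Variables (R : realType) (m M : nat).
Implicit Types P : 'M[R]_(m.+1, M).

Definition prob_matrix P : Prop :=
  (forall i j, 0 <= P i j <= 1) /\ \sum_(i < m.+1) \sum_(j < M) P i j = 1.

(* mxvec concatenates the rows from top to bottom; mxvec_index x u is the
   position of the entry (x, u). *)
Definition prob_vector P : 'rV[R]_(m.+1 * M) := mxvec P.

Definition coupling_poly P (x y : laurent R) : laurent R :=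
  \sum_(i < m.+1) \sum_(j < M) lmonom (P i j) 0 0 * x ^+ i * y ^+ j.

End Distribution.

Section BaseMatrixCycles.
Variables gamma kappa : nat.

(* A traversal (i_1, j_1, i_2, j_2, i_3, j_3), as its rows i and its columns j
   (with indices 0, 1, 2); its edges are (i_k, j_k) and (i_k, j_(k+1)), where
   k+1 is taken modulo 3, i.e. is ordS k. *)
Definition traversal : finType :=
  ({ffun 'I_3 -> 'I_gamma} * {ffun 'I_3 -> 'I_kappa})%type.

(* Every entry of the all-one base matrix is an edge, so only distinctness of
   the rows and of the columns is required. *)
Definition cycle6_candidate (c : traversal) : bool :=
  injectiveb c.1 && injectiveb c.2.

Definition rotate_traversal (c : traversal) : traversal :=
  ([ffun k => c.1 (ordS k)], [ffun k => c.2 (ordS k)]).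

(* (i_1, j_1, i_2, j_2, i_3, j_3) |-> (i_3, j_1, i_2, j_3, i_1, j_2) *)
Definition reverse_traversal (c : traversal) : traversal :=
  ([ffun k => c.1 (rev_ord k)], [ffun k => c.2 (ordS (rev_ord k))]).

(* The rotation is a permutation of order 3 and the reversal an involution, so
   that this reachability relation is an equivalence. *)
Definition same_cycle : rel traversal :=
  connect (fun c c' => (c' == rotate_traversal c) || (c' == reverse_traversal c)).

End BaseMatrixCycles.

Section MDProtograph.
Variables (gamma kappa m M : nat).
Implicit Types (Kx : 'M['I_m.+1]_(gamma, kappa)) (Mx : 'M['I_M]_(gamma, kappa)).
Implicit Type c : traversal gamma kappa.

Definition MD_candidate Kx Mx c : bool :=
  (\sum_(k < 3) ((Kx (c.1 k) (c.2 k))%:Z - (Kx (c.1 k) (c.2 (ordS k)))%:Z) == 0)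
  && (\sum_(k < 3) ((Mx (c.1 k) (c.2 k))%:Z - (Mx (c.1 k) (c.2 (ordS k)))%:Z)
        == 0 %[mod M])%Z.

Definition num_MD_candidates Kx Mx : nat :=
  #|equivalence_partition (@same_cycle gamma kappa)
      [set c | cycle6_candidate c && MD_candidate Kx Mx c]%SET|.

End MDProtograph.

Definition mutually_independent (d : measure_display) (Omega : measurableType d)
    (R : realType) (Pr : probability Omega R) (I : finType) (T : Type)
    (Z : I -> Omega -> T) : Prop :=
  forall (A : {set I}) (B : I -> set T),
    Pr (\bigcap_(q in [set` A]) (Z q @^-1` B q)) =
    (\prod_(q in A) Pr (Z q @^-1` B q))%E.

(* The pairs take finitely many values, so measurability of the fibres is
   measurability for the discrete sigma-algebra, and all subsets B q are
   legitimate events in mutually_independent. *)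
Record random_partitioning_relocation (d : measure_display)
    (Omega : measurableType d) (R : realType) (Pr : probability Omega R)
    (gamma kappa m M : nat) (pcon : 'rV[R]_(m.+1 * M))
    (K : Omega -> 'M['I_m.+1]_(gamma, kappa))
    (Mr : Omega -> 'M['I_M]_(gamma, kappa)) : Prop := {
  rpr_measurable : forall i j x u,
    measurable [set w | (K w i j, Mr w i j) = (x, u)] ;
  rpr_law : forall i j x u,
    Pr [set w | (K w i j, Mr w i j) = (x, u)] = (pcon 0 (mxvec_index x u))%:E ;
  rpr_independent : mutually_independent Pr
    (fun (q : 'I_gamma * 'I_kappa) w => (K w q.1 q.2, Mr w q.1 q.2)) }.

Section Expectations.
Context (d : measure_display) (Omega : measurableType d) (R : realType).
Context (Pr : probability Omega R) (gamma kappa m M : nat).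
Variable (K : Omega -> 'M['I_m.+1]_(gamma, kappa)).
Variable (Mr : Omega -> 'M['I_M]_(gamma, kappa)).

Definition P6 (c : traversal gamma kappa) : \bar R :=
  Pr [set w | MD_candidate (K w) (Mr w) c].

Definition N6 : \bar R :=
  ('E_Pr[fun w => (num_MD_candidates (K w) (Mr w))%:R])%E.

End Expectations.

(* Main.v *)
(* A candidate visits six distinct positions of the base matrix, three with
   sign + and three with sign -, and their pairs (K, M) are independent.  The
   probability that the alternating sum of the K's vanishes and that of the M's
   is divisible by M is therefore the sum of prod_t p(z_t) over the 6-tuples z
   of pairs meeting both conditions, and expanding f^3(X, Y) f^3(1/X, 1/Y) over
   the same 6-tuples gives the same sum.  For the expectation, the dihedral
   group of order 6 acts freely on the traversals of candidates and preserves
   both conditions, so a cycle is counted by exactly 6 of the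
   36 C(gamma, 3) C(kappa, 3) traversals. *)
Require Import Defs.
From mathcomp Require Import all_boot all_order all_algebra finmap.
From mathcomp Require Import all_classical all_reals all_analysis.
From mathcomp Require Import measurable_realfun ring.

Import Order.TTheory GRing.Theory Num.Theory.

Local Open Scope classical_set_scope.
Local Open Scope ring_scope.

(** * Coefficients of products and sums of monomials *)

Section LaurentCoefficients.
Context {R : comNzRingType}.

Lemma lcoef_lmonom (c : R) (a b x y : int) :
  lcoef (lmonom c a b) x y = if (x, y) == (a, b) then c else 0.
Proof. exact: (lmonomE c a b (x, y)). Qed.

Lemma lcoef_sum (I : Type) (r : seq I) (Q : pred I) (F : I -> laurent R)
    (a b : int) :
  lcoef (\sum_(i <- r | Q i) F i) a b = \sum_(i <- r | Q i) lcoef (F i) a b.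
Proof.
elim/big_rec2: _ => [|i y x _ <-]; first exact: (lzeroE _ (a, b)).
exact: (laddE _ _ (a, b)).
Qed.

Lemma prod_lmonom (I : Type) (r : seq I) (c : I -> R) (a b : I -> int) :
  \prod_(i <- r) lmonom (c i) (a i) (b i) =
  lmonom (\prod_(i <- r) c i) (\sum_(i <- r) a i) (\sum_(i <- r) b i).
Proof.
elim: r => [|i r IHr]; first by rewrite !big_nil.
by rewrite !big_cons IHr lmonomM.
Qed.

Lemma lmonomX (c : R) (a b : int) (n : nat) :
  lmonom c a b ^+ n = lmonom (c ^+ n) (a *+ n) (b *+ n).
Proof.
elim: n => [|n IHn]; first by rewrite !expr0 !mulr0n.
by rewrite !exprS !mulrS IHn lmonomM.
Qed.

(** Only the finitely many exponents [b i] can contribute, so the sum over the possibly infinite set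
    [B] is finite. Several [i] may share an exponent; exchanging the two sums avoids collecting like
    terms. *)
Lemma fsum_lcoef_sum_lmonom (I : finType) (c : I -> R) (a b : I -> int)
    (x : int) (B : set int) :
  \sum_(y \in B) lcoef (\sum_i lmonom (c i) (a i) (b i)) x y =
  \sum_(i | (a i == x) && (b i \in B)) c i.
Proof.
pose r := undup [seq b i | i : I].
have br i : b i \in r by rewrite mem_undup map_f ?mem_enum.
rewrite (fsbigE [seq y <- r | y \in B]) /=; first last.
- move=> y By yr; rewrite lcoef_sum big1// => i _; rewrite lcoef_lmonom.
  case: eqP => // -[_ yE]; case/negP: yr.
  by rewrite mem_filter yE br -yE andbT; exact/mem_set.
- by move=> y /=; rewrite mem_filter => /andP[/set_mem].
- by rewrite filter_uniq// undup_uniq.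
under eq_bigr do rewrite lcoef_sum.
rewrite big_filter_cond exchange_big [RHS]big_mkcond; apply: eq_bigr => i _.
under eq_bigr do rewrite lcoef_lmonom xpair_eqE eq_sym.
(* For fixed [i] the only exponent [y] with a nonzero term is [b i], which [undup] lists exactly
   once. *)
rewrite big_mkcond (bigD1_seq (b i)) ?undup_uniq//= andbb eqxx andbT.
rewrite big1 ?addr0 => [|y /negPf ->]; last by rewrite andbF if_same.
by case: (a i == x) => //=; rewrite if_same.
Qed.

End LaurentCoefficients.

(** * Expansion of the powers of the coupling polynomial *)

Section CouplingPolynomial.
Context {R : realType} {m M : nat} (P : 'M[R]_(m.+1, M)).
Local Notation D := ('I_m.+1 * 'I_M)%type.
Local Notation f := (coupling_poly P).

(** The cases [s = 1] and [s = -1] are f(X, Y) and f(1/X, 1/Y), so that both kinds of factor are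
    handled at once. *)
Lemma coupling_poly_lmonom (s : int) :
  f (lmonom 1 s 0) (lmonom 1 0 s) =
  \sum_(x : D) lmonom (P x.1 x.2) (s * (x.1 : nat)%:Z) (s * (x.2 : nat)%:Z).
Proof.
rewrite /coupling_poly pair_bigA; apply: eq_bigr => x _ /=.
have sE (k : nat) : s *+ k = s * k%:Z by rewrite -mulr_natr natz.
by rewrite !lmonomX !lmonomM !expr1n !mulr1 !mul0rn !addr0 !add0r !sE.
Qed.

(* The index (b, k) of a factor records its sign (-1)^b: b = false for the
   factors f(X, Y), b = true for the factors f(X^-1, Y^-1). *)
Lemma coupling_poly_pow (n : nat) :
  f lX lY ^+ n * f lX^-1 lY^-1 ^+ n =
  \sum_(z : {ffun bool * 'I_n -> D})
    lmonom (\prod_t P (z t).1 (z t).2)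
      (\sum_(t : bool * 'I_n) (-1) ^+ t.1 * ((z t).1 : nat)%:Z)
      (\sum_(t : bool * 'I_n) (-1) ^+ t.1 * ((z t).2 : nat)%:Z).
Proof.
under eq_bigr do rewrite -prod_lmonom.
(* Distributivity read backwards: the sum over all functions [z] factors into a product over [t] of
   sums over a single pair. *)
rewrite -(bigA_distr_bigA (fun (t : bool * 'I_n) (x : D) =>
  lmonom (P x.1 x.2) ((-1) ^+ t.1 * (x.1 : nat)%:Z)
                     ((-1) ^+ t.1 * (x.2 : nat)%:Z))).
pose F (b : bool) (k : 'I_n) := \sum_(x : D)
  lmonom (P x.1 x.2) ((-1) ^+ b * (x.1 : nat)%:Z) ((-1) ^+ b * (x.2 : nat)%:Z).
rewrite -(pair_bigA _ F) big_bool /= !prodr_const card_ord mulrC.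
by rewrite lX_inv lY_inv -!coupling_poly_lmonom.
Qed.

Lemma fsum_lcoef_coupling_poly_pow (n : nat) :
  \sum_(b \in [set b : int | (M %| b)%Z])
    lcoef (f lX lY ^+ n * f lX^-1 lY^-1 ^+ n) 0 b =
  \sum_(z : {ffun bool * 'I_n -> D} |
      (\sum_(t : bool * 'I_n) (-1) ^+ t.1 * ((z t).1 : nat)%:Z == 0) &&
      (M %| \sum_(t : bool * 'I_n) (-1) ^+ t.1 * ((z t).2 : nat)%:Z)%Z)
    \prod_t P (z t).1 (z t).2.
Proof.
under eq_fsbigr do rewrite coupling_poly_pow.
rewrite fsum_lcoef_sum_lmonom; apply: eq_bigl => z.
by congr (_ && _); apply/idP/idP => [/set_mem|/mem_set].
Qed.

End CouplingPolynomial.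

(** * Joint law of independent variables with finitely many values *)

Section JointLaw.
Context {d : measure_display} {Omega : measurableType d} {R : realType}.
Context {Pr : probability Omega R} {I D : finType}.
Context {Z : I -> Omega -> D} {p : D -> R}.
Hypothesis mZ : forall i x, measurable [set w | Z i w = x].
Hypothesis lawZ : forall i x, Pr [set w | Z i w = x] = (p x)%:E.
Hypothesis indZ : mutually_independent Pr Z.
Context {J : finType} {e : J -> I}.
Hypothesis inj_e : injective e.
Implicit Types (z : {ffun J -> D}) (Q : pred {ffun J -> D}).

Let fibre z : set Omega := [set w | [ffun t => Z (e t) w] = z].

Let fibreE z : fibre z = \bigcap_t [set w | Z (e t) w = z t].
Proof.
apply/seteqP; split => w /= => [<- t _|zE]; first by rewrite /= ffunE.
by apply/ffunP => t; rewrite ffunE; exact: zE.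
Qed.

Let measurable_fibre z : measurable (fibre z).
Proof.
by rewrite fibreE; apply: fin_bigcap_measurable => // t _; exact: mZ.
Qed.

Lemma joint_law z :
  Pr [set w | [ffun t => Z (e t) w] = z] = (\prod_t p (z t))%:E.
Proof.
(* Independence asks for events indexed by [I], while [z] is indexed by [J]. Quantifying over the
   preimages of [i] transports [z] along [e]; at [i = e t], injectivity leaves only the value
   [z t]. *)
pose B i : set D := [set x | forall t, e t = i -> x = z t].
have fB t : Z (e t) @^-1` B (e t) = [set w | Z (e t) w = z t].
  apply/seteqP; split => w /=; first by exact.
  by move=> ZE t' /inj_e ->.
have := indZ (e @: [set: J])%SET B.
rewrite [X in Pr X = _](_ : _ = fibre z); last first.
  rewrite fibreE; apply/seteqP; split => w /=.
    move=> h t _; have : w \in Z (e t) @^-1` B (e t).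
      by apply/mem_set; apply: h; apply: imset_f; rewrite finset.in_setT.
    by rewrite fB => /set_mem.
  move=> h i /= /imsetP[t _ ->].
  by have := h t Logic.I; rewrite -fB.
move=> ->; rewrite big_imset /=; last by move=> ? ? _ _; exact: inj_e.
rewrite (eq_bigl xpredT) => [|t]; last by rewrite finset.in_setT.
rewrite -prodEFin; apply: eq_bigr => t _.
by rewrite fB lawZ.
Qed.

Lemma measurable_joint Q :
  measurable [set w | Q [ffun t => Z (e t) w]].
Proof.
rewrite [X in measurable X](_ : _ = \bigcup_(z in [set` Q]) fibre z).
  by apply: fin_bigcup_measurable => // z _; exact: measurable_fibre.
apply/seteqP; split => w /=; last by move=> [z Qz /= ->].
by move=> Qw; exists [ffun t => Z (e t) w].
Qed.

(** The event is the disjoint union of the fibres over the tuples satisfying [Q], and each fibre has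
    the product probability. *)
Lemma prob_joint Q :
  Pr [set w | Q [ffun t => Z (e t) w]] =
  (\sum_(z | Q z) \prod_t p (z t))%:E.
Proof.
rewrite [X in Pr X](_ : _ = \bigcup_(z in [set` Q]) fibre z); last first.
  apply/seteqP; split => w /=; last by move=> [z Qz /= ->].
  by move=> Qw; exists [ffun t => Z (e t) w].
rewrite measure_fin_bigcup//; last first.
  by move=> z z' _ _ [w []]; rewrite /fibre/= => -> ->.
rewrite -(@bigfs _ _ _ _ (index_enum {ffun J -> D})) ?index_enum_uniq//;
  last by move=> z; rewrite mem_index_enum.
by rewrite -sumEFin; apply: eq_bigr => z _; exact: joint_law.
Qed.

End JointLaw.

(** * The dihedral action on traversals and the size of its orbits *)

Section CycleClasses.
Context {gamma kappa : nat}.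
Local Notation trav := (traversal gamma kappa).
Implicit Types (c : trav) (g : bool * 'I_3).

(** With rotation rho and reversal sigma, the pair (b, k) encodes rho^k sigma^b, the normal form of
    an element of the dihedral group of order 6. *)
Definition dihedral_act g c : trav :=
  iter g.2 (@rotate_traversal gamma kappa)
    (if g.1 then reverse_traversal c else c).

Lemma ordS3K (k : 'I_3) : ordS (ordS (ordS k)) = k.
Proof. by case: k => -[|[|[|//]]] i; apply: val_inj. Qed.

Lemma ordS_rev_ordS3 (k : 'I_3) : ordS (rev_ord (ordS k)) = rev_ord k.
Proof. by case: k => -[|[|[|//]]] i; apply: val_inj. Qed.

Lemma rotate_traversal3 c :
  rotate_traversal (rotate_traversal (rotate_traversal c)) = c.
Proof.
by case: c => r s; congr (_, _); apply/ffunP => k;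
  rewrite !ffunE /= ?ffunE ordS3K.
Qed.

Lemma reverse_traversalK : involutive (@reverse_traversal gamma kappa).
Proof.
case=> r s; congr (_, _); apply/ffunP => k; rewrite !ffunE/= ?rev_ordK//.
by congr (s _); case: k => -[|[|[|//]]] i; apply: val_inj.
Qed.

(** The dihedral relation rho sigma rho = sigma, which brings words in rho and sigma to normal
    form. *)
Lemma reverse_rotate_traversal c :
  rotate_traversal (reverse_traversal (rotate_traversal c)) =
  reverse_traversal c.
Proof.
case: c => r s; congr (_, _); apply/ffunP => k; rewrite !ffunE /= ?ffunE;
  by [congr (r _); case: k => -[|[|[|//]]] i; apply: val_inj
     |congr (s _); case: k => -[|[|[|//]]] i; apply: val_inj].
Qed.

Let step c c' := (c' == rotate_traversal c) || (c' == reverse_traversal c).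

Let step_rotate c : connect step c (rotate_traversal c).
Proof. by apply: connect1; rewrite /step eqxx. Qed.

Let step_reverse c : connect step c (reverse_traversal c).
Proof. by apply: connect1; rewrite /step eqxx orbT. Qed.

Lemma rotate_dihedral_act g c :
  exists g', rotate_traversal (dihedral_act g c) = dihedral_act g' c.
Proof.
case: g => b k; exists (b, ordS k); rewrite /dihedral_act /=.
by case: k => -[|[|[|//]]] i //=; rewrite rotate_traversal3.
Qed.

Lemma reverse_dihedral_act g c :
  exists g', reverse_traversal (dihedral_act g c) = dihedral_act g' c.
Proof.
have rr c' : reverse_traversal (rotate_traversal c') =
    rotate_traversal (rotate_traversal (reverse_traversal c')).
  by rewrite -(reverse_rotate_traversal c') rotate_traversal3.
case: g => b k.
(* Here sigma rho^k sigma^b = rho^(-k) sigma^(b+1); the reduction modulo 3 matters for [k = 0]. *)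
exists (~~ b, inord ((3 - k) %% 3)); rewrite /dihedral_act /= inordK ?ltn_pmod//.
by case: k => -[|[|[|//]]] i; case: b => /=;
  rewrite ?rr ?rotate_traversal3 ?reverse_traversalK.
Qed.

(** The six images of [c] include [c] itself and are closed under both generators, so no path leaves
    them; conversely each normal form spells out a path. *)
Lemma same_cycleP c c' :
  reflect (exists g, c' = dihedral_act g c) (same_cycle c c').
Proof.
apply: (iffP idP) => [/connectP[s]|[[b k] ->]]; last first.
  rewrite /same_cycle -/step /dihedral_act /=.
  have : connect step c (if b then reverse_traversal c else c).
    by case: b => //; exact: connect0.
  elim: (k : nat) (if b then _ else c) => //= n IHn c1 cc1.
  by apply: connect_trans (IHn _ cc1) _; exact: step_rotate.
elim/last_ind: s c' => [|s c1 IHs] c' /=.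
  by move=> _ ->; exists (false, ord0).
rewrite rcons_path last_rcons => /andP[ps] /orP lst ->.
have [g gE] := IHs _ ps erefl; rewrite gE in lst.
by case: lst => /eqP ->;
  [exact: rotate_dihedral_act | exact: reverse_dihedral_act].
Qed.

Lemma same_cycle_equivalence : equivalence_rel (@same_cycle gamma kappa).
Proof.
have sym c c' : same_cycle c c' -> same_cycle c' c.
  move=> /same_cycleP[[b k] ->]; rewrite /dihedral_act /=.
  apply: (@connect_trans _ _ (if b then reverse_traversal c else c)).
    move: (if b then _ else c) => c1.
    case: k => -[|[|[|//]]] i /=; first exact: connect0.
      (* A rotation is undone by two further rotations, and a double rotation by one. *)
      rewrite -{2}[c1]rotate_traversal3.
      exact: connect_trans (step_rotate _) (step_rotate _).
    by rewrite -{2}[c1]rotate_traversal3; exact: step_rotate.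
  case: b; last exact: connect0.
  by rewrite -{2}[c]reverse_traversalK; exact: step_reverse.
move=> c1 c2 c3; split; first exact: connect0.
move=> c12; apply/idP/idP; last exact: connect_trans.
by apply: connect_trans; exact: sym.
Qed.

(** The action is free already on the rows: the six elements induce the six permutations of the
    three indices, and distinct rows tell these apart. *)
Lemma dihedral_act_inj c : cycle6_candidate c -> injective (dihedral_act^~ c).
Proof.
case: c => r s /andP[/= /injectiveP r_inj _].
have rows g k : (dihedral_act g (r, s)).1 k =
    r (if g.1 then rev_ord (iter g.2 (@ordS 3) k) else iter g.2 (@ordS 3) k).
  case: g => b [[|[|[|//]]] i]; rewrite /dihedral_act/= ?ffunE; case: b => //=;
  by rewrite !ffunE.
move=> [b k] [b' k'] e.
have E l := r_inj _ _ (etrans (esym (rows (b, k) l))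
  (etrans (congr1 (fun c : trav => c.1 l) e) (rows (b', k') l))).
(* A permutation of three indices is determined by its values at 0 and 1. *)
move: (congr1 val (E (Ordinal (isT : 0 < 3)%N))).
move: (congr1 val (E (Ordinal (isT : 1 < 3)%N))).
by case: b b' k k' {e E} => -[] [[|[|[|//]]] i] [[|[|[|//]]] j] //= _ _;
  congr (_, _); apply: val_inj.
Qed.

Lemma card_same_cycle c : cycle6_candidate c ->
  #|[set c' | same_cycle c c']%SET| = 6%N.
Proof.
move=> cand_c; have -> : [set c' | same_cycle c c']%SET =
    [set dihedral_act g c | g : bool * 'I_3]%SET.
  apply/setP => c'; rewrite !finset.inE.
  by apply/same_cycleP/imsetP => [[g ->]|[g _ ->]]; exists g.
by rewrite card_imset ?card_prod ?card_bool ?card_ord//;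
  exact: dihedral_act_inj.
Qed.

(** Closure under the two generators makes [C] a union of whole orbits, and each orbit of a
    candidate has 6 elements. *)
Lemma card_equivalence_partition_same_cycle (C : {set trav}) :
  {in C, forall c, cycle6_candidate c} ->
  {in C, forall c, rotate_traversal c \in C} ->
  {in C, forall c, reverse_traversal c \in C} ->
  #|C| = (#|equivalence_partition (@same_cycle gamma kappa) C| * 6)%N.
Proof.
move=> candC rotC revC.
apply: card_uniform_partition; last first.
  by apply: equivalence_partitionP => x y z _ _ _; exact: same_cycle_equivalence.
move=> _ /imsetP[c cC ->]; rewrite -(card_same_cycle c (candC c cC)).
apply: eq_card => c'; rewrite !finset.inE andb_idl// => /same_cycleP[[b k] ->].
rewrite /dihedral_act /=.
have : (if b then reverse_traversal c else c) \in C.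
  by case: b => //; exact: revC.
by elim: (k : nat) (if b then _ else c) => //= n IHn c1 c1C; exact/rotC/IHn.
Qed.

Lemma card_cycle6_candidate :
  #|[set c : trav | cycle6_candidate c]%SET| =
  (36 * 'C(gamma, 3) * 'C(kappa, 3))%N.
Proof.
have -> : [set c : trav | cycle6_candidate c]%SET =
    finset.setX [set r : {ffun 'I_3 -> 'I_gamma} | injectiveb r]%SET
      [set s : {ffun 'I_3 -> 'I_kappa} | injectiveb s]%SET.
  by apply/setP => -[r s]; rewrite !finset.inE.
(* Rows and columns each contribute 3! orderings of a 3-subset, whence 36. *)
rewrite cardsX !card_inj_ffuns !card_ord -!bin_ffact.
by rewrite mulnACA mulnC mulnA.
Qed.

Lemma cycle6_candidate_rotate c :
  cycle6_candidate c -> cycle6_candidate (rotate_traversal c).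
Proof.
move=> /andP[/injectiveP r_inj /injectiveP s_inj].
by apply/andP; split; apply/injectiveP => k l; rewrite !ffunE;
  [move=> /r_inj/ordS_inj | move=> /s_inj/ordS_inj].
Qed.

Lemma cycle6_candidate_reverse c :
  cycle6_candidate c -> cycle6_candidate (reverse_traversal c).
Proof.
move=> /andP[/injectiveP r_inj /injectiveP s_inj].
apply/andP; split; apply/injectiveP => k l; rewrite !ffunE.
  by move=> /r_inj/rev_ord_inj.
by move=> /s_inj/ordS_inj/rev_ord_inj.
Qed.

Definition alt_sum {n : nat} (A : 'M['I_n]_(gamma, kappa)) c : int :=
  \sum_(k < 3) ((A (c.1 k) (c.2 k))%:Z - (A (c.1 k) (c.2 (ordS k)))%:Z).

Lemma alt_sum_rotate n (A : 'M['I_n]_(gamma, kappa)) c :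
  alt_sum A (rotate_traversal c) = alt_sum A c.
Proof.
rewrite /alt_sum [RHS](reindex_inj (@ordS_inj 3)).
by apply: eq_bigr => k _; rewrite !ffunE.
Qed.

(** Reversal exchanges the two edges in each row, hence the signs; vanishing and divisibility by [M]
    survive negation. *)
Lemma alt_sum_reverse n (A : 'M['I_n]_(gamma, kappa)) c :
  alt_sum A (reverse_traversal c) = - alt_sum A c.
Proof.
rewrite /alt_sum [in RHS](reindex_inj rev_ord_inj) -sumrN.
by apply: eq_bigr => k _; rewrite !ffunE ordS_rev_ordS3 opprB.
Qed.

End CycleClasses.

(** * Counting cycles by their traversals *)

Section CountMD.
Context {gamma kappa m M : nat}.
Implicit Types (Kx : 'M['I_m.+1]_(gamma, kappa)) (Mx : 'M['I_M]_(gamma, kappa)).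
Implicit Type c : traversal gamma kappa.

Lemma MD_candidateE Kx Mx c :
  MD_candidate Kx Mx c = (alt_sum Kx c == 0) && (M %| alt_sum Mx c)%Z.
Proof. by rewrite /MD_candidate eqz_mod_dvd subr0. Qed.

Lemma MD_candidate_rotate Kx Mx c :
  MD_candidate Kx Mx (rotate_traversal c) = MD_candidate Kx Mx c.
Proof. by rewrite !MD_candidateE !alt_sum_rotate. Qed.

Lemma MD_candidate_reverse Kx Mx c :
  MD_candidate Kx Mx (reverse_traversal c) = MD_candidate Kx Mx c.
Proof. by rewrite !MD_candidateE !alt_sum_reverse oppr_eq0 !dvdzE abszN. Qed.

(** This replaces a number of classes by a sum of indicators, to which linearity of expectation
    applies. *)
Lemma num_MD_candidatesE Kx Mx :
  (num_MD_candidates Kx Mx * 6 =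
   \sum_(c : traversal gamma kappa | cycle6_candidate c) MD_candidate Kx Mx c)%N.
Proof.
rewrite -card_equivalence_partition_same_cycle.
- by rewrite -sum1dep_card big_mkcondr; apply: eq_bigr => c _; case: ifP.
- by move=> c; rewrite finset.inE => /andP[].
- move=> c; rewrite !finset.inE => /andP[cand ?].
  by rewrite MD_candidate_rotate cycle6_candidate_rotate.
- move=> c; rewrite !finset.inE => /andP[cand ?].
  by rewrite MD_candidate_reverse cycle6_candidate_reverse.
Qed.

End CountMD.

(** * The probability and the expectation *)

Section MDExpectation.
Context {R : realType} {gamma kappa m M : nat} {P : 'M[R]_(m.+1, M)}.
Context {d : measure_display} {Omega : measurableType d}.
Context {Pr : probability Omega R}.
Context {K : Omega -> 'M['I_m.+1]_(gamma, kappa)}.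
Context {Mr : Omega -> 'M['I_M]_(gamma, kappa)}.
Hypothesis hKM : random_partitioning_relocation Pr (prob_vector P) K Mr.
Local Notation D := ('I_m.+1 * 'I_M)%type.
Implicit Type c : traversal gamma kappa.

Let Z (q : 'I_gamma * 'I_kappa) w : D := (K w q.1 q.2, Mr w q.1 q.2).

(** The bit is the sign, as in [coupling_poly_pow]: [false] for the edge (i_k, j_k), [true] for
    (i_k, j_(k+1)). *)
Let edge c (t : bool * 'I_3) : 'I_gamma * 'I_kappa :=
  (c.1 t.2, c.2 (if t.1 then ordS t.2 else t.2)).

(** Distinct rows determine [k]; within a row the bit is recovered from the column, as [ordS k]
    differs from [k]. *)
Let edge_inj c : cycle6_candidate c -> injective (edge c).
Proof.
move=> /andP[/injectiveP r_inj /injectiveP s_inj] [b k] [b' k'] [/r_inj /= <-].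
move=> /s_inj; case: b b' => -[] // /(congr1 val) /=;
  by case: k => -[|[|[|//]]].
Qed.

(** The condition selecting tuples in [fsum_lcoef_coupling_poly_pow] for exponent 3, so that the
    probability and the coefficient sum agree term by term. *)
Let balanced (z : {ffun bool * 'I_3 -> D}) : bool :=
  (\sum_(t : bool * 'I_3) (-1) ^+ t.1 * ((z t).1 : nat)%:Z == 0) &&
  (M %| \sum_(t : bool * 'I_3) (-1) ^+ t.1 * ((z t).2 : nat)%:Z)%Z.

Let alt_sum_edge n (A : 'M['I_n]_(gamma, kappa)) c :
  \sum_(t : bool * 'I_3)
     (-1) ^+ t.1 * (A (edge c t).1 (edge c t).2 : nat)%:Z = alt_sum A c.
Proof.
pose F (b : bool) (k : 'I_3) : int :=
  (-1) ^+ b * (A (edge c (b, k)).1 (edge c (b, k)).2 : nat)%:Z.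
rewrite (eq_bigr (fun t => F t.1 t.2)) => [|[]//].
rewrite -(pair_bigA _ F) big_bool /= -big_split; apply: eq_bigr => k _ /=.
by rewrite /F expr1 expr0 mul1r mulN1r addrC.
Qed.

Let MD_candidate_balanced c w :
  MD_candidate (K w) (Mr w) c = balanced [ffun t => Z (edge c t) w].
Proof.
rewrite MD_candidateE -!alt_sum_edge.
by congr ((_ == _) && (_ %| _)%Z); apply: eq_bigr => t _; rewrite ffunE.
Qed.

Let measurable_Z q x : measurable [set w | Z q w = x].
Proof. by case: x => x u; exact: (rpr_measurable hKM). Qed.

Let law_Z q x : Pr [set w | Z q w = x] = (P x.1 x.2)%:E.
Proof. by case: x => x u; rewrite (rpr_law hKM) mxvecE. Qed.

Lemma measurable_MD_candidate c :
  measurable [set w | MD_candidate (K w) (Mr w) c].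
Proof.
rewrite (_ : mkset _ = [set w | balanced [ffun t => Z (edge c t) w]]).
  exact: measurable_joint.
by apply/seteqP; split => w /=; rewrite MD_candidate_balanced.
Qed.

Lemma P6E c : cycle6_candidate c ->
  P6 Pr K Mr c = (\sum_(b \in [set b : int | (M %| b)%Z])
    lcoef (coupling_poly P lX lY ^+ 3 * coupling_poly P lX^-1 lY^-1 ^+ 3) 0 b)%:E.
Proof.
move=> cand_c; rewrite /P6 fsum_lcoef_coupling_poly_pow.
rewrite (_ : mkset _ = [set w | balanced [ffun t => Z (edge c t) w]]).
  rewrite (prob_joint measurable_Z law_Z (rpr_independent hKM)) //.
  exact: edge_inj.
by apply/seteqP; split => w /=; rewrite MD_candidate_balanced.
Qed.

Lemma N6E : (N6 Pr K Mr =
  (6^-1)%:E *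
    \sum_(c : traversal gamma kappa | cycle6_candidate c) P6 Pr K Mr c)%E.
Proof.
pose X c (w : Omega) : \bar R :=
  (\1_[set w | MD_candidate (K w) (Mr w) c] w)%:E.
rewrite /N6 unlock -big_filter.
set s := [seq _ <- _ | _].
(* Pointwise, the number of cycles is one sixth of the sum of the indicators over all candidate
   traversals. *)
transitivity (\int[Pr]_w ((6^-1)%:E * \sum_(c <- s) X c w))%E.
  apply: eq_integral => w _; rewrite sumEFin -EFinM; congr (_%:E).
  rewrite [X in _ = _ * X](_ : _ = (num_MD_candidates (K w) (Mr w) * 6)%:R).
    by rewrite natrM mulrC mulfK ?pnatr_eq0.
  rewrite num_MD_candidatesE natr_sum big_filter; apply: eq_bigr => c _.
  rewrite indicE; congr (nat_of_bool _)%:R.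
  by apply/idP/idP => [/set_mem|/mem_set].
have mX c : measurable_fun [set: Omega] (X c : Omega -> \bar R).
  by apply/measurable_EFinP; apply: measurable_indic;
    exact: measurable_MD_candidate.
have X0 c w : (0 <= X c w)%E by rewrite lee_fin.
rewrite ge0_integralZl_EFin //; last 2 first.
- by move=> w _; exact: sume_ge0.
- exact: emeasurable_sum.
rewrite ge0_integral_sum//; congr (_ * _)%E; apply: eq_bigr => c _.
by rewrite integral_indic ?setIT//; exact: measurable_MD_candidate.
Qed.

End MDExpectation.

Theorem theorem1 (R : realType) (gamma kappa m M : nat)
    (hgamma : (3 <= gamma)%N) (hkappa : (gamma < kappa)%N)
    (hm : (1 <= m)%N) (hM : (2 <= M)%N)
    (P : 'M[R]_(m.+1, M)) (hP : prob_matrix P)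
    (d : measure_display) (Omega : measurableType d) (Pr : probability Omega R)
    (K : Omega -> 'M['I_m.+1]_(gamma, kappa))
    (Mr : Omega -> 'M['I_M]_(gamma, kappa))
    (hKM : random_partitioning_relocation Pr (prob_vector P) K Mr) :
  let f := coupling_poly P in
  let S : R := \sum_(b \in [set b : int | (M %| b)%Z])
                 lcoef (f lX lY ^+ 3 * f lX^-1 lY^-1 ^+ 3) 0 b in
  (forall c : traversal gamma kappa, cycle6_candidate c ->
     P6 Pr K Mr c = S%:E) /\
  N6 Pr K Mr = (6 * 'C(gamma, 3)%:R * 'C(kappa, 3)%:R * S)%:E.
Proof.
move=> f S; have P6S c : cycle6_candidate c -> P6 Pr K Mr c = S%:E.
  exact: P6E.
split=> //; rewrite (N6E hKM) (eq_bigr (fun=> S%:E)) => [|c]; last exact: P6S.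
rewrite sumEFin -EFinM; congr (_%:E).
(* All terms equal [S], and the factor 6 of the result is 36 / 6. *)
rewrite sumr_const -[#|_|]cardsE card_cycle6_candidate.
rewrite -[S *+ _]mulr_natr !natrM.
by field.
Qed.
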